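(* The Hopf algebra $\mathcal{H}_X^\circ$ of rooted circle trees decorated by $X$ and the Hopf algebra $H$ (both over $\mathbb{R}$, as described in the context) are isomorphic as Hopf algebras.
   Context: Fix $m\ge1$ and the alphabet $X=\{x_0,\ldots,x_m\}$; $X^*$ is the set of words over $X$ (including the empty word $\emptyset$), and $|\eta|_{x_j}$ is the number of occurrences of $x_j$ in $\eta$. $\mathcal{H}_X^\circ$: A rooted circle tree (rct) $c^i$ consists of a root labelled $i\in\{1,\ldots,m\}$ and a finite, possibly empty, sequence of internal vertices $v_1<\cdots<v_k$, each decorated by a letter of $X$ (vertices decorated $x_0$ are white, others black). Degree $\mathsf{deg}(c^i)=2(\#\text{white})+(\#\text{black})+1$. $\mathcal{H}_X^\circ$ is the commutative polynomial $\mathbb{R}$-algebra freely generated by all rcts (product = disjoint union). An admissible subset of $c^i$ is a nonempty set $J$ of internal vertices whose minimal element is white. For pairwise disjoint admissible $J_1,\ldots,J_k$ with minima $w_1<\cdots<w_k$ and $n_1,\ldots,n_k\in\{1,\ldots,m\}$: $(c^i/J_1\cup\cdots\cup J_k)_{n_1\cdots n_k}$ is the rct with root $i$ and internal vertices those of $c^i$ outside $\bigcup J_a$ together with $w_1,\ldots,w_k$ (induced order), $w_a$ redecorated by $x_{n_a}$; $c^{n_a}_{|J_a}$ is the rct with root label $n_a$ and internal vertices $J_a\setminus\{w_a\}$ (induced order, same decorations). Coproduct: $$\Delta(c^i)=c^i\otimes\mathbf{1}+\mathbf{1}\otimes c^i+\sum_{\{J_1,\ldots,J_k\}}\sum_{n_1,\ldots,n_k=1}^m(c^i/J_1\cup\cdots\cup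 J_k)_{n_1\cdots n_k}\otimes c^{n_1}_{|J_1}\cdots c^{n_k}_{|J_k},$$ over all nonempty sets of pairwise disjoint admissible subsets, extended multiplicatively. $H$: For $i\in\{1,\ldots,m\}$ and $\eta\in X^*$ let $a^i_\eta$ be a formal symbol (the coordinate map $c\mapsto(c_i,\eta)$ on $\mathbb{R}^m\langle\langle X\rangle\rangle$), of degree $2|\eta|_{x_0}+\sum_{j=1}^m|\eta|_{x_j}+1$. Let $V$ be their $\mathbb{R}$-span, and $H$ the free commutative unital $\mathbb{R}$-algebra on $V$ with product $m_H$ and unit $\mathbf{1}$. Let $\theta_k$ ($k=0,\ldots,m$) be the linear map $\theta_k a^i_\eta=a^i_{x_k\eta}$. For $j=1,\ldots,m$ define $\Delta^j_{\sqcup\!\sqcup}:V\to V\otimes V$ by $\Delta^j_{\sqcup\!\sqcup}a^i_\emptyset=a^i_\emptyset\otimes a^j_\emptyset$ and $\Delta^j_{\sqcup\!\sqcup}\circ\theta_k=(\theta_k\otimes\mathrm{id}+\mathrm{id}\otimes\theta_k)\circ\Delta^j_{\sqcup\!\sqcup}$. Define $\tilde\Delta:V\to V\otimes H$ recursively by $\tilde\Delta a^i_\emptyset=a^i_\emptyset\otimes\mathbf{1}$, $\tilde\Delta\circ\theta_k=(\theta_k\otimes\mathrm{id})\circ\tilde\Delta$ for $k=1,\ldots,m$, and $$\tilde\Delta\circ\theta_0=(\theta_0\otimes\mathrm{id})\circ\tilde\Delta+\sum_{j=1}^m(\theta_j\otimes m_H)\circ(\tilde\Delta\otimes\mathrm{id})\circ\Delta^j_{\sqcup\!\sqcup}.$$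 (Equivalently, $\tilde\Delta a^i_\eta(c,d)=(c_i\,\tilde\circ\, d,\eta)$ for the modified composition product of series.) The coproduct of $H$ is $\Delta a^i_\eta=\tilde\Delta a^i_\eta+\mathbf{1}\otimes a^i_\eta$, extended multiplicatively with $\Delta\mathbf{1}=\mathbf{1}\otimes\mathbf{1}$; with this, $H$ is a connected graded commutative Hopf algebra. *)

(* Defs.v *)
From HB Require Import structures.
From mathcomp Require Import all_boot all_order all_algebra.
From mathcomp Require Import finmap.
From mathcomp.multinomials Require Import monalg.
From mathcomp Require Export reals.

Set Implicit Arguments.
Unset Strict Implicit.
Unset Printing Implicit Defensive.

Import GRing.Theory.
Local Open Scope ring_scope.

(* Conventions.  [{malg R[K]}] is the free R-module on the basis K; for a basis
   K that is a (commutative) monoid it is the corresponding monoid algebra.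
   [freeCom R I = {malg R[{cmonom I}]}] is thus the commutative polynomial
   algebra freely generated by the (possibly infinite) set I.  The tensor
   product of the free modules on K and L is the free module on K * L, the pure
   tensor of basis elements k (x) l being the basis element (k, l). *)

Section ProdMonom.
Variables M N : conomType.
Implicit Types x y z : (M * N)%type.

Definition prodm_one : M * N := (mone, mone).
Definition prodm_mul x y : M * N := (mmul x.1 y.1, mmul x.2 y.2).

Lemma prodm_mulA : associative prodm_mul.
Proof. by move=> x y z; rewrite /prodm_mul /= !mulmA. Qed.

Lemma prodm_mul1m : left_id prodm_one prodm_mul.
Proof. by case=> x y; rewrite /prodm_mul /= !mul1m. Qed.

Lemma prodm_mulm1 : right_id prodm_one prodm_mul.
Proof. by case=> x y; rewrite /prodm_mul /= !mulm1. Qed.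

Lemma prodm_unitm x y :
  prodm_mul x y = prodm_one -> x = prodm_one /\ y = prodm_one.
Proof.
by case: x y => [a b] [c d] [] /unitm [-> ->] /unitm [-> ->].
Qed.

Lemma prodm_mulC : commutative prodm_mul.
Proof.
by move=> x y; rewrite /prodm_mul (mulmC x.1 y.1) (mulmC x.2 y.2).
Qed.

HB.instance Definition _ := Choice_isMonomialDef.Build (M * N)%type
  prodm_mulA prodm_mul1m prodm_mulm1 prodm_unitm.
HB.instance Definition _ :=
  MonomialDef_isConomialDef.Build (M * N)%type prodm_mulC.

End ProdMonom.

(* The linear map with prescribed values on the basis K. *)
HB.lock Definition linext (R : comNzRingType) (K : choiceType)
    (W : lmodType R) (f : K -> W) (x : {malg R[K]}) : W :=
  \sum_(k <- msupp x) x@_k *: f k.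

(* The pure tensor x (x) y. *)
HB.lock Definition tens (R : comNzRingType) (K L : choiceType)
    (x : {malg R[K]}) (y : {malg R[L]}) : {malg R[(K * L)%type]} :=
  \sum_(k <- msupp x) \sum_(l <- msupp y) << x@_k * y@_l *g (k, l) >>.

Section LinearExtension.
Variable R : comNzRingType.

Lemma linextEw (K : choiceType) (W : lmodType R) (f : K -> W)
    (d : {fset K}) (x : {malg R[K]}) :
  (msupp x `<=` d)%fset -> linext f x = \sum_(k <- d) x@_k *: f k.
Proof.
move=> le; rewrite unlock; apply: big_fset_incl => // k _.
by move/mcoeff_outdom=> ->; rewrite scale0r.
Qed.

Lemma linext_is_linear (K : choiceType) (W : lmodType R) (f : K -> W) :
  linear (linext f).
Proof.
move=> a x y; pose d := (msupp x `|` msupp y)%fset.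
rewrite (@linextEw _ _ f d x) ?fsubsetUl // (@linextEw _ _ f d y) ?fsubsetUr //.
rewrite (@linextEw _ _ f d).
  rewrite scaler_sumr -big_split /=; apply: eq_bigr => k _.
  by rewrite mcoeffD mcoeffZ scalerDl scalerA.
apply: (fsubset_trans (msuppD_le _ _)).
by rewrite fsetSU // msuppZ_le.
Qed.

HB.instance Definition _ (K : choiceType) (W : lmodType R) (f : K -> W) :=
  GRing.isLinear.Build R {malg R[K]} W _ (linext f) (linext_is_linear f).

Lemma linextU (K : choiceType) (W : lmodType R) (f : K -> W) (k : K) :
  linext f << k >> = f k.
Proof.
by rewrite unlock msuppU oner_eq0 big_seq_fset1 mcoeffUU scale1r.
Qed.

Lemma malgU_scale (K : choiceType) (c : R) (k : K) :
  << c *g k >> = c *: << k >> :> {malg R[K]}.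
Proof. by apply/malgP => a; rewrite mcoeffZ !mcoeffU mulrnAr mulr1. Qed.

Lemma mcoeff_tens (K L : choiceType) (x : {malg R[K]}) (y : {malg R[L]}) k l :
  (tens x y)@_(k, l) = x@_k * y@_l.
Proof.
rewrite {2}(monalgE x) {2}(monalgE y) !raddf_sum mulr_suml unlock raddf_sum.
apply: eq_bigr => k' _; rewrite raddf_sum mulr_sumr; apply: eq_bigr => l' _.
rewrite /= !mcoeffU xpair_eqE.
by do 2!case: (_ == _); rewrite ?mulr0 ?mul0r.
Qed.

(* The map f (x) g. *)
Definition tensmap (K L K' L' : choiceType)
    (f : {malg R[K]} -> {malg R[K']}) (g : {malg R[L]} -> {malg R[L']}) :
    {malg R[(K * L)%type]} -> {malg R[(K' * L')%type]} :=
  linext (fun p : K * L => tens (f << p.1 >>) (g << p.2 >>)).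

HB.instance Definition _ (K L K' L' : choiceType)
    (f : {malg R[K]} -> {malg R[K']}) (g : {malg R[L]} -> {malg R[L']}) :=
  GRing.Linear.on (tensmap f g).

End LinearExtension.

Section FreeCommutativeAlgebra.
Variable R : comNzRingType.

Definition freeCom (I : choiceType) := {malg R[{cmonom I}]}.
Definition freeCom2 (I : choiceType) := {malg R[({cmonom I} * {cmonom I})%type]}.

HB.instance Definition _ (I : choiceType) := GRing.ComAlgebra.on (freeCom I).
HB.instance Definition _ (I : choiceType) := GRing.ComAlgebra.on (freeCom2 I).

Definition gen (I : choiceType) (i : I) : freeCom I := << ucm i >>.

Section AlgebraExtension.
Variables (I : choiceType) (S : comAlgType R) (f : I -> S).

Definition algext_mon (u : {cmonom I}) : S := \prod_(i <- finsupp u) f i ^+ u i.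

Lemma algext_monEw (d : {fset I}) (u : {cmonom I}) :
  (finsupp u `<=` d)%fset -> algext_mon u = \prod_(i <- d) f i ^+ u i.
Proof.
move=> le; apply: big_fset_incl => // i _.
by rewrite -cmE_eq0 => /eqP ->; rewrite expr0.
Qed.

Lemma algext_mon_mmorphism : mmorphism algext_mon.
Proof.
split=> [u v|]; last by rewrite /algext_mon mdom1 big_seq_fset0.
pose d := (finsupp u `|` finsupp v)%fset.
rewrite !(@algext_monEw d) ?mdomD ?fsubsetUl ?fsubsetUr //.
by rewrite -big_split; apply: eq_bigr => i _; rewrite cmM exprD.
Qed.

HB.instance Definition _ :=
  isMultiplicative.Build {cmonom I} S algext_mon algext_mon_mmorphism.

(* The unital algebra morphism with prescribed values on the generators. *)
Definition algext : freeCom I -> S := mmap (in_alg S) algext_mon.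

HB.instance Definition _ := GRing.RMorphism.on algext.

Lemma algextZ : scalable algext.
Proof. by move=> c x; rewrite /algext mmapZ /= mulr_algl. Qed.

HB.instance Definition _ :=
  GRing.isScalable.Build R (freeCom I) S *:%R algext algextZ.

Lemma algext_gen i : algext (gen i) = f i.
Proof.
by rewrite /algext mmapU /= scale1r mul1r /algext_mon mdomU big_seq_fset1 cmUU.
Qed.
End AlgebraExtension.

Definition mulT (I : choiceType) : freeCom2 I -> freeCom I :=
  linext (fun p : {cmonom I} * {cmonom I} => << mmul p.1 p.2 >> : freeCom I).

(* The counit of a connected graded Hopf algebra: it vanishes on every
   generator, the generators having positive degree. *)
Definition counit (I : choiceType) (x : freeCom I) : R := x@_mone.

Definition is_antipode (I : choiceType) (D : freeCom I -> freeCom2 I)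
    (S : {linear freeCom I -> freeCom I}) : Prop :=
  forall x, mulT (tensmap S idfun (D x)) = (counit x)%:A
         /\ mulT (tensmap idfun S (D x)) = (counit x)%:A.

(* The antipode of a connected graded bialgebra is uniquely determined by the
   coproduct, whence the quantification in the last clause. *)
Definition is_hopf_iso (I J : choiceType)
    (DI : freeCom I -> freeCom2 I) (DJ : freeCom J -> freeCom2 J)
    (phi : {lrmorphism freeCom I -> freeCom J}) : Prop :=
  [/\ bijective phi,
      forall x, DJ (phi x) = tensmap phi phi (DI x),
      forall x, counit (phi x) = counit x &
      forall SI SJ, is_antipode DI SI -> is_antipode DJ SJ ->
        forall x, phi (SI x) = SJ (phi x)].

Definition hopf_isomorphic (I J : choiceType)
    (DI : freeCom I -> freeCom2 I) (DJ : freeCom J -> freeCom2 J) : Prop :=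
  exists phi : {lrmorphism freeCom I -> freeCom J}, is_hopf_iso DI DJ phi.

End FreeCommutativeAlgebra.

(* The alphabet {x_0, ..., x_m} is ['I_m.+1]; an index j in {1, ..., m} is
   represented by the element j - 1 of ['I_m], and [xl j] is the letter x_j. *)
Definition x0 {m : nat} : 'I_m.+1 := ord0.
Definition xl {m : nat} (j : 'I_m) : 'I_m.+1 := lift ord0 j.

(* The root label, and the decorations of the internal vertices listed in
   increasing order; the internal vertices are the elements of ['I_(nv c)]. *)
Record rct (m : nat) := Rct { rlabel : 'I_m; vdeco : seq 'I_m.+1 }.

Section RctChoice.
Variable m : nat.
Definition rct_pair (c : rct m) := (rlabel c, vdeco c).
Definition pair_rct (p : 'I_m * seq 'I_m.+1) := Rct p.1 p.2.
Lemma rct_pairK : cancel rct_pair pair_rct. Proof. by case. Qed.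
HB.instance Definition _ := Choice.copy (rct m) (can_type rct_pairK).
End RctChoice.

Section CircleTrees.
Variables (R : comNzRingType) (m : nat).
Implicit Types c : rct m.

Definition nv c := size (vdeco c).
Definition deco c (v : 'I_(nv c)) : 'I_m.+1 := tnth (in_tuple (vdeco c)) v.

Definition is_min n (J : {set 'I_n}) (w : 'I_n) : bool :=
  (w \in J) && [forall v in J, (w <= v)%N].

(* Having a minimal element, J is nonempty. *)
Definition admissible c (J : {set 'I_(nv c)}) : bool :=
  [exists w, is_min J w && (deco w == x0)].

Definition extraction c (P : {set {set 'I_(nv c)}}) : bool :=
  [&& P != set0, trivIset P & [forall J in P, admissible J]].

(* A choice of labels n_1, ..., n_k for the members of the family P. *)
Definition labelling c (P : {set {set 'I_(nv c)}}) : Type :=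
  {ffun {J : {set 'I_(nv c)} | J \in P} -> 'I_m}.

HB.instance Definition _ c (P : {set {set 'I_(nv c)}}) :=
  Finite.on (labelling P).

Definition redeco c (P : {set {set 'I_(nv c)}}) (n : labelling P)
    (v : 'I_(nv c)) : 'I_m.+1 :=
  if [pick J : {J : {set 'I_(nv c)} | J \in P} | is_min (val J) v] is Some J
  then xl (n J) else deco v.

Definition contract c (P : {set {set 'I_(nv c)}}) (n : labelling P) : rct m :=
  Rct (rlabel c)
    [seq redeco n v | v <- enum 'I_(nv c)
       & (v \notin cover P) || [exists J in P, is_min J v]].

Definition extracted c (J : {set 'I_(nv c)}) (n : 'I_m) : rct m :=
  Rct n [seq deco v | v <- enum 'I_(nv c) & (v \in J) && ~~ is_min J v].

Definition rct_coprod_gen c : freeCom2 R (rct m) :=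
  tens (gen R c) 1 + tens 1 (gen R c) +
  \sum_(P : {set {set 'I_(nv c)}} | extraction P)
    \sum_(n : labelling P)
      tens (gen R (contract n))
           (\prod_(J : {J : {set 'I_(nv c)} | J \in P})
              gen R (extracted (val J) (n J))).

Definition rct_coprod : freeCom R (rct m) -> freeCom2 R (rct m) :=
  algext rct_coprod_gen.

End CircleTrees.

(* [(i, eta)] is the formal symbol a^i_eta. *)
Definition hcoord (m : nat) : Type := ('I_m * seq 'I_m.+1)%type.
HB.instance Definition _ (m : nat) := Choice.on (hcoord m).

Section CoordinateMaps.
Variables (R : comNzRingType) (m : nat).

Local Notation M := {cmonom (hcoord m)}.
Local Notation V := {malg R[hcoord m]}.
Local Notation H := (freeCom R (hcoord m)).
Local Notation VV := {malg R[(hcoord m * hcoord m)%type]}.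
Local Notation VH := {malg R[(hcoord m * M)%type]}.
Local Notation VHV := {malg R[((hcoord m * M) * hcoord m)%type]}.

Definition crd (i : 'I_m) (w : seq 'I_m.+1) : V := << ((i, w) : hcoord m) >>.

Definition theta (k : 'I_m.+1) : V -> V := linext (fun a => crd a.1 (k :: a.2)).

HB.instance Definition _ (k : 'I_m.+1) := GRing.Linear.on (theta k).

Fixpoint shuffle_crd (j i : 'I_m) (w : seq 'I_m.+1) : VV :=
  if w is k :: w' then
    let D := shuffle_crd j i w' in
    tensmap (theta k) idfun D + tensmap idfun (theta k) D
  else tens (crd i [::]) (crd j [::]).

Definition shuffle (j : 'I_m) : V -> VV :=
  linext (fun a => shuffle_crd j a.1 a.2).

HB.instance Definition _ (j : 'I_m) := GRing.Linear.on (shuffle j).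

Definition inclV : V -> H := linext (@gen R (hcoord m)).

(* theta_j (x) m_H, with V included in H in the last factor. *)
Definition theta_mul (j : 'I_m) : VHV -> VH :=
  linext (fun p : (hcoord m * M) * hcoord m =>
         tens (theta (xl j) << p.1.1 >>) ((<< p.1.2 >> : H) * inclV << p.2 >>)).

HB.instance Definition _ (j : 'I_m) := GRing.Linear.on (theta_mul j).

(* One unfolding of the recursion defining [tdelta].  Since the recursive calls
   also reach the terms of [shuffle j], the recursion is on a bound [n] of the
   length of words; [tdelta_nil], [tdelta_theta] and [tdelta_theta0] below are
   the equations that characterise [tdelta]. *)
Definition tdelta_step (D : V -> VH) (i : 'I_m) (w : seq 'I_m.+1) : VH :=
  if w is k :: w' then
    tensmap (theta k) idfun (D (crd i w')) +
    (if k == x0 then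
       \sum_(j < m) theta_mul j (tensmap D idfun (shuffle j (crd i w')))
     else 0)
  else tens (crd i [::]) (1 : H).

Fixpoint tdelta_rec (n : nat) : V -> VH :=
  if n is n'.+1 then linext (fun a => tdelta_step (tdelta_rec n') a.1 a.2)
  else fun=> 0.

Definition tdelta : V -> VH :=
  linext (fun a => tdelta_rec (size a.2).+1 << a >>).

HB.instance Definition _ := GRing.Linear.on (tdelta).

Definition crd_coprod_gen (a : hcoord m) : freeCom2 R (hcoord m) :=
  tensmap inclV idfun (tdelta << a >>) + tens 1 (gen R a).

Definition crd_coprod : H -> freeCom2 R (hcoord m) := algext crd_coprod_gen.

Lemma thetaU k (i : 'I_m) w : theta k (crd i w) = crd i (k :: w).
Proof. by rewrite /theta /crd linextU. Qed.

Lemma shuffleU j i w : shuffle j (crd i w) = shuffle_crd j i w.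
Proof. by rewrite /shuffle /crd linextU. Qed.

Lemma V_ind (W : lmodType R) (f g : {linear V -> W}) :
  (forall i w, f (crd i w) = g (crd i w)) -> f =1 g.
Proof.
move=> fg v; rewrite (monalgE v) !linear_sum; apply: eq_bigr => -[i w] _ /=.
by rewrite malgU_scale !linearZ /=; congr (_ *: _); apply: fg.
Qed.

Lemma shuffle_nil j i :
  shuffle j (crd i [::]) = tens (crd i [::]) (crd j [::]).
Proof. by rewrite shuffleU. Qed.

Lemma shuffle_theta j k v :
  shuffle j (theta k v) =
  tensmap (theta k) idfun (shuffle j v) + tensmap idfun (theta k) (shuffle j v).
Proof.
pose f : {linear V -> VV} := shuffle j \o theta k.
pose g : {linear V -> VV} := (tensmap (theta k) idfun \o shuffle j) \+
                             (tensmap idfun (theta k) \o shuffle j).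
apply: (V_ind (f := f) (g := g)) => i w /=.
by rewrite thetaU [LHS]shuffleU shuffleU.
Qed.

Definition wbound (n : nat) (x : VV) :=
  forall a b : hcoord m, (n < size a.2)%N -> x@_(a, b) = 0.

Lemma wbound_tens n (x y : V) :
  (forall a : hcoord m, a \in msupp x -> (size a.2 <= n)%N) ->
  wbound n (tens x y).
Proof.
move=> hx a b lt; rewrite unlock !raddf_sum big_seq big1 // => k kx /=.
rewrite raddf_sum big1 // => l _ /=; rewrite mcoeffU.
case: eqP => // -[ka _]; move: (hx k kx); rewrite ka leqNgt lt //.
Qed.

Lemma wbound_tensmap n n' (f g : V -> V) (x : VV) :
  (forall a c : hcoord m, (size a.2 <= n)%N -> c \in msupp (f << a >>) ->
     (size c.2 <= n')%N) ->
  wbound n x -> wbound n' (tensmap f g x).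
Proof.
move=> hf hx a b lt; rewrite /tensmap linext.unlock raddf_sum big_seq big1 //.
move=> [c d] cx /=; rewrite mcoeffZ (_ : _@_(a, b) = 0) ?mulr0 //.
apply: wbound_tens lt => e; apply: hf; rewrite leqNgt; apply/negP => cn.
by move: cx; rewrite -mcoeff_neq0 hx ?eqxx.
Qed.

Lemma wbound_shuffle j i w : wbound (size w) (shuffle_crd j i w).
Proof.
elim: w => [|k w IHw] /=.
  apply: wbound_tens => a; rewrite /crd msuppU oner_eq0.
  by rewrite in_fset1 => /eqP ->.
move=> a b lt; rewrite mcoeffD.
have E1 : wbound (size w).+1 (tensmap (theta k) idfun (shuffle_crd j i w)).
  apply: wbound_tensmap IHw => {a b lt} a c le.
  rewrite /theta linextU /crd msuppU oner_eq0 in_fset1 => /eqP -> /=.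
  by rewrite ltnS.
have E2 : wbound (size w).+1 (tensmap idfun (theta k) (shuffle_crd j i w)).
  apply: wbound_tensmap IHw => {a b lt E1} a c le.
  rewrite /= msuppU oner_eq0 in_fset1 => /eqP -> /=.
  exact: leqW.
by rewrite (E1 _ _ lt) (E2 _ _ lt) addr0.
Qed.

Lemma eq_tensmap_shuffle (D D' : V -> VH) j i w :
  (forall a : hcoord m, (size a.2 <= size w)%N -> D << a >> = D' << a >>) ->
  tensmap D (@idfun V) (shuffle_crd j i w) =
  tensmap D' idfun (shuffle_crd j i w).
Proof.
move=> DD'; rewrite /tensmap linext.unlock [LHS]big_seq [RHS]big_seq.
apply: eq_bigr => -[a b] ab /=; rewrite DD' // leqNgt; apply/negP => lt.
by move: ab; rewrite -mcoeff_neq0 (@wbound_shuffle j i w a b lt) eqxx.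
Qed.

Lemma eq_tdelta_step (D D' : V -> VH) i w :
  (forall a : hcoord m, (size a.2 < size w)%N -> D << a >> = D' << a >>) ->
  tdelta_step D i w = tdelta_step D' i w.
Proof.
case: w => //= k w DD'; rewrite {1}/crd DD' //; congr (_ + _).
case: eqP => // _; apply: eq_bigr => j _; congr theta_mul.
by rewrite shuffleU; apply: eq_tensmap_shuffle.
Qed.

Lemma tdelta_rec_stable n (a : hcoord m) :
  (size a.2 < n)%N -> tdelta_rec n << a >> = tdelta << a >>.
Proof.
have [N] := ubnP n; elim: N n a => // N IHN [//|n] [i w] /=.
rewrite ltnS => nN wn; rewrite /tdelta !linextU /= linextU /=.
apply: eq_tdelta_step => b bw.
rewrite (IHN n b nN (leq_trans bw wn)) (IHN (size w)) //.
by apply: leq_ltn_trans nN; rewrite -ltnS.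
Qed.

Lemma tdeltaU i w : tdelta (crd i w) = tdelta_step tdelta i w.
Proof.
rewrite /crd -(@tdelta_rec_stable (size w).+1) //= linextU /=.
by apply: eq_tdelta_step => a; apply: tdelta_rec_stable.
Qed.

Lemma tdelta_nil i : tdelta (crd i [::]) = tens (crd i [::]) (1 : H).
Proof. by rewrite tdeltaU. Qed.

Lemma tdelta_theta (k : 'I_m) v :
  tdelta (theta (xl k) v) = tensmap (theta (xl k)) idfun (tdelta v).
Proof.
pose f : {linear V -> VH} := tdelta \o theta (xl k).
pose g : {linear V -> VH} := tensmap (theta (xl k)) idfun \o tdelta.
apply: (V_ind (f := f) (g := g)) => i w /=.
by rewrite thetaU [LHS]tdeltaU /= addr0.
Qed.

Lemma tdelta_theta0 v :
  tdelta (theta x0 v) =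
  tensmap (theta x0) idfun (tdelta v) +
  \sum_(j < m) theta_mul j (tensmap tdelta idfun (shuffle j v)).
Proof.
pose h0 (u : V) :=
  \sum_(j < m) theta_mul j (tensmap tdelta idfun (shuffle j u)).
have h0_lin : linear h0.
  move=> a x y; rewrite scaler_sumr -big_split /=.
  by apply: eq_bigr => j _; rewrite !linearP.
pose h : {linear V -> VH} :=
  HB.pack h0 (GRing.isLinear.Build R V VH _ h0 h0_lin).
pose f : {linear V -> VH} := tdelta \o theta x0.
pose g : {linear V -> VH} := (tensmap (theta x0) idfun \o tdelta) \+ h.
apply: (V_ind (f := f) (g := g)) => i w /=.
by rewrite thetaU [LHS]tdeltaU.
Qed.

End CoordinateMaps.

(* Main.v *)
Require Import Defs.
From mathcomp Require Import all_boot all_order all_algebra.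
From HB Require Import structures.
From mathcomp Require Import finmap.
From mathcomp.multinomials Require Import monalg.

(* The isomorphism sends the circle tree with root [i] and decorations [eta],
   listed in increasing order, to [a^i_eta].  The coproducts agree because of
   the following recursion on a set [U] of vertices with least element [u].
   Either no extracted set contains [u], which corresponds to [theta_k (x) id];
   or [u] is the (white) minimum of a set [{u} + S] with [S] inside [U - u],
   and [u] becomes [x_j] while the remaining sets are extracted from
   [U - u - S].  The sum over all [S] is the deshuffling [Delta^j] of the word
   read off [U - u].  The coproduct is triangular for the degree, hence determines
   the antipode. *)

Set Implicit Arguments.
Unset Strict Implicit.
Unset Printing Implicit Defensive.

Import GRing.Theory.
Local Open Scope ring_scope.

(** * Bilinearity of tensors and extensionality for linear maps on free modules *)

Section FreeModules.
Variable R : comNzRingType.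
Implicit Types K L : choiceType.

Lemma malg_span K (P : {malg R[K]} -> Prop) :
  P 0 -> (forall a x y, P x -> P y -> P (a *: x + y)) ->
  (forall k, P << k >>) -> forall x, P x.
Proof.
move=> P0 PL PU x; rewrite (monalgE x); elim/big_rec: _ => // k y _ Py.
by rewrite malgU_scale; apply: PL.
Qed.

Lemma malg_ext K (W : lmodType R) (f g : {linear {malg R[K]} -> W}) :
  (forall k, f << k >> = g << k >>) -> f =1 g.
Proof.
move=> fg v; rewrite (monalgE v) !linear_sum; apply: eq_bigr => k _ /=.
by rewrite malgU_scale !linearZ /= fg.
Qed.

Lemma tens_linearl K L (y : {malg R[L]}) :
  linear (fun x : {malg R[K]} => tens x y).
Proof.
move=> a x x'; apply/malgP => -[k l].
by rewrite mcoeffD mcoeffZ !mcoeff_tens mcoeffD mcoeffZ mulrDl mulrA.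
Qed.

Lemma tens_linearr K L (x : {malg R[K]}) :
  linear (fun y : {malg R[L]} => tens x y).
Proof.
move=> a y y'; apply/malgP => -[k l].
by rewrite mcoeffD mcoeffZ !mcoeff_tens mcoeffD mcoeffZ mulrDr mulrCA.
Qed.

Lemma tensU K L (k : K) (l : L) :
  tens << k >> << l >> = << (k, l) >> :> {malg R[_]}.
Proof.
apply/malgP => -[k' l']; rewrite mcoeff_tens !mcoeffU xpair_eqE.
by do 2!case: (_ == _); rewrite ?mulr0 ?mul0r ?mulr1.
Qed.

HB.instance Definition _ K L (x : {malg R[K]}) :=
  GRing.isLinear.Build R {malg R[L]} {malg R[(K * L)%type]} _ (tens x)
    (tens_linearr x).

(** The varying argument comes last, so that the partial application [tens_flip y] can carry the
    structure of a linear map. *)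
Definition tens_flip K L (y : {malg R[L]}) (x : {malg R[K]}) := tens x y.

HB.instance Definition _ K L (y : {malg R[L]}) :=
  GRing.isLinear.Build R {malg R[K]} {malg R[(K * L)%type]} _
    (@tens_flip K L y) (tens_linearl y).

Lemma tens0l K L (y : {malg R[L]}) : tens (0 : {malg R[K]}) y = 0.
Proof. exact: (linear0 (tens_flip y)). Qed.

Lemma tensPl K L (y : {malg R[L]}) a (x x' : {malg R[K]}) :
  tens (a *: x + x') y = a *: tens x y + tens x' y.
Proof. exact: tens_linearl. Qed.

Lemma tens_suml K L (y : {malg R[L]}) (J : Type) (r : seq J) (P : pred J)
    (F : J -> {malg R[K]}) :
  tens (\sum_(j <- r | P j) F j) y = \sum_(j <- r | P j) tens (F j) y.
Proof. exact: (linear_sum (tens_flip y)). Qed.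

Lemma tens_ext K L (W : lmodType R)
    (f g : {linear {malg R[(K * L)%type]} -> W}) :
  (forall k l, f (tens << k >> << l >>) = g (tens << k >> << l >>)) -> f =1 g.
Proof. by move=> fg; apply: malg_ext => -[k l]; rewrite -tensU. Qed.

Lemma tensmapU K L K' L' (f : {malg R[K]} -> {malg R[K']})
    (g : {malg R[L]} -> {malg R[L']}) k l :
  tensmap f g << (k, l) >> = tens (f << k >>) (g << l >>).
Proof. by rewrite /tensmap linextU. Qed.

Lemma tensmap_tens K L K' L' (f : {linear {malg R[K]} -> {malg R[K']}})
    (g : {linear {malg R[L]} -> {malg R[L']}}) x y :
  tensmap f g (tens x y) = tens (f x) (g y).
Proof.
pose h1 : {linear _ -> _} := tensmap f g \o tens_flip y.
pose h2 : {linear _ -> _} := tens_flip (g y) \o f.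
apply: (malg_ext (f := h1) (g := h2)) => k /=; rewrite /tens_flip.
pose h3 : {linear _ -> _} := tensmap f g \o tens << k >>.
pose h4 : {linear _ -> _} := tens (f << k >>) \o g.
by apply: (malg_ext (f := h3) (g := h4)) => l /=; rewrite tensU tensmapU.
Qed.

End FreeModules.

(** * Algebra morphisms out of free commutative algebras and their tensor squares *)

Section FreeAlgebras.
Variable R : comNzRingType.
Implicit Types I J : choiceType.

Lemma malgUM (K : monomType) (u v : K) :
  << mmul u v >> = << u >> * << v >> :> {malg R[K]}.
Proof. by rewrite malgM_def fgmulUU mulr1. Qed.

Lemma malg1E (K : monomType) : 1 = << mone >> :> {malg R[K]}.
Proof. by []. Qed.

(** Linearity in each of the four arguments reduces the identity to basis elements, where it is the
    product of pairs of monomials. *)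
Lemma tensM (K L : conomType) (x x' : {malg R[K]}) (y y' : {malg R[L]}) :
  tens (x * x') (y * y') = tens x y * tens x' y' :> {malg R[_]}.
Proof.
elim/malg_span: x => [|a x1 x2 IH1 IH2|u].
  by rewrite mul0r !tens0l mul0r.
  by rewrite mulrDl -scalerAl !tensPl IH1 IH2 mulrDl scalerAl.
elim/malg_span: x' => [|a x1 x2 IH1 IH2|u'].
  by rewrite mulr0 !tens0l mulr0.
  by rewrite mulrDr -scalerAr !tensPl IH1 IH2 mulrDr scalerAr.
elim/malg_span: y => [|a x1 x2 IH1 IH2|v].
  by rewrite mul0r !linear0 mul0r.
  by rewrite mulrDl -scalerAl !linearP /= IH1 IH2 mulrDl scalerAl.
elim/malg_span: y' => [|a x1 x2 IH1 IH2|v'].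
  by rewrite mulr0 !linear0 mulr0.
  by rewrite mulrDr -scalerAr !linearP /= IH1 IH2 mulrDr scalerAr.
by rewrite -!malgUM !tensU -malgUM.
Qed.

Lemma tens11 I J : tens (1 : freeCom R I) (1 : freeCom R J) = 1.
Proof. by rewrite !malg1E tensU. Qed.

(** Induction on the degree: a nontrivial monomial is divisible by any generator of its support, and
    the quotient has degree one less. *)
Lemma cmonom_ind I (P : {cmonom I} -> Prop) :
  P mone -> (forall i u, P u -> P (mmul (ucm i) u)) -> forall u, P u.
Proof.
move=> P1 PM u; have [n] := ubnP (mdeg u); elim: n u => // n IHn u.
case: (eqVneq u mone) => [->//|u1 un].
have /fset0Pn[i iu] : finsupp u != fset0.
  apply: contra u1 => /eqP u0; rewrite -mdeg_eq0 mdegE u0.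
  by rewrite big_seq_fset0.
have uE : u = mmul (ucm i) (divcm u (ucm i)).
  apply/eqP/cmP => j; rewrite cmM divcmE ucmE subnKC //.
  by case: eqP => // <-; rewrite lt0n cmE_neq0.
rewrite uE; apply/PM/IHn; move: un.
by rewrite {1}uE mdegM mdegU add1n.
Qed.

Lemma freeCom_ext I (S : comAlgType R) (f g : {lrmorphism freeCom R I -> S}) :
  (forall i, f (gen R i) = g (gen R i)) -> f =1 g.
Proof.
move=> fg.
have hM (h : {lrmorphism freeCom R I -> S}) i u :
    h << mmul (ucm i) u >> = h (gen R i) * h << u >>.
  by rewrite -rmorphM malgUM.
have fgU u : f << u >> = g << u >>.
  elim/cmonom_ind: u => [|i u IHu].
    by transitivity (1 : S); [|symmetry]; apply: rmorph1.
  apply: etrans (hM f i u) _; apply: etrans (esym (hM g i u)).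
  exact: (congr2 *%R (fg i) IHu).
exact: (malg_ext (f := f) (g := g) fgU).
Qed.

Lemma tensmapM (K L K' L' : conomType) (f : {malg R[K]} -> {malg R[K']})
    (g : {malg R[L]} -> {malg R[L']}) :
  {morph f : x y / x * y} -> {morph g : x y / x * y} ->
  {morph tensmap f g : x y / x * y}.
Proof.
move=> fM gM x y.
have lP a u v : tensmap f g (a *: u + v) = a *: tensmap f g u + tensmap f g v.
  exact: linearP.
have l0 : tensmap f g 0 = 0 by exact: linear0.
elim/malg_span: x => [|a x1 x2 IH1 IH2|u].
- by rewrite mul0r l0 mul0r.
- by rewrite mulrDl -scalerAl !lP IH1 IH2 mulrDl scalerAl.
elim/malg_span: y => [|a x1 x2 IH1 IH2|v].
- by rewrite mulr0 l0 mulr0.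
- by rewrite mulrDr -scalerAr !lP IH1 IH2 mulrDr scalerAr.
rewrite -malgUM (tensmapU f g (mmul u.1 v.1) (mmul u.2 v.2)).
rewrite !malgUM fM gM tensM.
by congr (_ * _); rewrite -tensmapU -surjective_pairing.
Qed.

(** With [tensmap f f] an algebra morphism, compatibility with the coproducts becomes an identity
    between algebra morphisms, which can be checked on generators. *)
Lemma tensmap_monoid_morphism I J
    (f : {lrmorphism freeCom R I -> freeCom R J}) :
  monoid_morphism (tensmap f f : freeCom2 R I -> freeCom2 R J).
Proof.
split=> [|x y]; last by apply: (tensmapM (f := f) (g := f)); apply: rmorphM.
rewrite -(tens11 I I) (tensmap_tens f f) -(tens11 J J).
by congr tens; apply: rmorph1.
Qed.

HB.instance Definition _ I J (f : {lrmorphism freeCom R I -> freeCom R J}) :=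
  GRing.isMonoidMorphism.Build (freeCom2 R I) (freeCom2 R J)
    (tensmap f f : freeCom2 R I -> freeCom2 R J)
    (tensmap_monoid_morphism f).

Lemma mulT_tens I (x y : freeCom R I) : mulT (tens x y) = x * y.
Proof.
rewrite /mulT.
elim/malg_span: x => [|a x1 x2 IH1 IH2|u].
- by rewrite mul0r tens0l linear0.
- by rewrite tensPl linearP /= IH1 IH2 mulrDl scalerAl.
elim/malg_span: y => [|a x1 x2 IH1 IH2|v].
- by rewrite mulr0 !linear0.
- by rewrite linearP linearP /= IH1 IH2 mulrDr scalerAr.
by rewrite tensU linextU -malgUM.
Qed.

HB.instance Definition _ I := GRing.Linear.on (@mulT R I).

Lemma mulT_morph I J (f : {lrmorphism freeCom R I -> freeCom R J}) x :
  f (mulT x) = mulT (tensmap f f x).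
Proof.
pose h1 : {linear freeCom2 R I -> freeCom R J} := f \o @mulT R I.
pose h2 : {linear freeCom2 R I -> freeCom R J} := @mulT R J \o tensmap f f.
apply: (tens_ext (f := h1) (g := h2)) => k l /=.
by rewrite mulT_tens tensmap_tens mulT_tens rmorphM.
Qed.

Lemma counit_morph I J (f : {lrmorphism freeCom R I -> freeCom R J}) :
  (forall i, counit (f (gen R i)) = 0) -> forall x, counit (f x) = counit x.
Proof.
move=> f0 x; rewrite /counit; elim/malg_span: x => [|a x y IHx IHy|u].
- by rewrite linear0 !mcoeff0.
- by rewrite linearP !mcoeffD !mcoeffZ IHx IHy.
elim/cmonom_ind: u => [|i u _].
  rewrite mcoeffUU.
  exact: etrans (congr1 (mcoeff mone) (rmorph1 f)) (mcoeffUU _ _).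
(* The constant coefficient is multiplicative, so one generator factor is enough to annihilate
   it. *)
have mM (K : choiceType) (y z : freeCom R K) :
    (y * z)@_mone = y@_mone * z@_mone.
  exact: rmorphM.
have -> : f << mmul (ucm i) u >> = f (gen R i) * f << u >>.
  by rewrite malgUM; apply: rmorphM.
by rewrite mM [X in X * _ = _](f0 i) mul0r mcoeffU cmM_eq1 cm1_eq1.
Qed.

(** * Triangularity of coproducts and cancellation in the convolution product *)

Section WeightFiltration.
Variables (I : choiceType) (d : I -> nat).

Definition wt (u : {cmonom I}) : nat := \sum_(i <- finsupp u) u i * d i.

Lemma wtEw (D : {fset I}) (u : {cmonom I}) :
  (finsupp u `<=` D)%fset -> wt u = (\sum_(i <- D) u i * d i)%N.
Proof.
move=> le; apply: big_fset_incl => // i _.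
by rewrite -cmE_eq0 => /eqP ->.
Qed.

Lemma wt1 : wt mone = 0%N.
Proof. by rewrite /wt mdom1 big_seq_fset0. Qed.

Lemma wtU i : wt (ucm i) = d i.
Proof. by rewrite /wt mdomU big_seq_fset1 cmUU mul1n. Qed.

Lemma wtM u v : wt (mmul u v) = (wt u + wt v)%N.
Proof.
pose D := (finsupp u `|` finsupp v)%fset.
rewrite !(@wtEw D) ?mdomD ?fsubsetUl ?fsubsetUr //.
by rewrite -big_split; apply: eq_bigr => i _; rewrite cmM mulnDl.
Qed.

(** Only the left tensor factor is measured: it is the one to which the antipode is applied in
    [tensmap S idfun]. *)
Definition wt_below n (x : freeCom2 R I) :=
  forall u v, (n <= wt u)%N -> x@_(u, v) = 0.

Lemma wt_belowD n x y : wt_below n x -> wt_below n y -> wt_below n (x + y).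
Proof. by move=> hx hy u v le; rewrite mcoeffD hx ?hy ?addr0. Qed.

Lemma wt_below_sum n (J : Type) (r : seq J) (P : pred J)
    (F : J -> freeCom2 R I) :
  (forall j, P j -> wt_below n (F j)) -> wt_below n (\sum_(j <- r | P j) F j).
Proof.
move=> hF; elim/big_rec: _ => [u v _|j x Pj]; first by rewrite mcoeff0.
exact/wt_belowD/hF.
Qed.

Lemma wt_below_leq n n' x : (n <= n')%N -> wt_below n x -> wt_below n' x.
Proof. by move=> le hx u v /(leq_trans le); apply: hx. Qed.

Lemma wt_below_tens n u (x : freeCom R I) :
  (wt u < n)%N -> wt_below n (tens << u >> x).
Proof.
move=> lt u' v' le; rewrite mcoeff_tens mcoeffU.
by case: eqP => [uu'|]; rewrite ?mul0r //; move: lt; rewrite uu' ltnNge le.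
Qed.

(** Left weights below [n] on one side and at most [n'] on the other add up to weights below
    [n + n']; one strict bound is enough. *)
Lemma wt_belowM n n' x y :
  wt_below n x -> wt_below n'.+1 y -> wt_below (n + n') (x * y).
Proof.
move=> hx hy u v le; rewrite malgME !raddf_sum big_seq big1 // => -[a b] ab /=.
rewrite raddf_sum big_seq big1 // => -[a' b'] ab' /=.
rewrite mcoeffU; case: eqP => // -[uE _]; move: le; rewrite -uE wtM leqNgt.
have la : (wt a < n)%N.
  by rewrite ltnNge; apply/negP => /hx h; move: ab; rewrite -mcoeff_neq0 h eqxx.
have la' : (wt a' <= n')%N.
  rewrite leqNgt; apply/negP => /hy h.
  by move: ab'; rewrite -mcoeff_neq0 h eqxx.
by rewrite -addSn leq_add.
Qed.

(** The leading term propagates from generators to monomials through [a * b - p * q = (a - p) * b +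
    (b - q) * p]: each summand has one factor of strictly lower weight. *)
Lemma wt_below_leading (D : {lrmorphism freeCom R I -> freeCom2 R I}) :
  (forall i, wt_below (d i) (D (gen R i) - tens (gen R i) 1)) ->
  forall u, wt_below (wt u) (D << u >> - tens << u >> 1).
Proof.
move=> hD; elim/cmonom_ind => [|i u IHu].
  have -> : D << mone >> = 1 by apply: rmorph1.
  by move=> u v _; rewrite -malg1E tens11 subrr mcoeff0.
have -> : D << mmul (ucm i) u >> = D (gen R i) * D << u >>.
  by rewrite malgUM; apply: rmorphM.
have -> : tens << mmul (ucm i) u >> (1 : freeCom R I) =
    tens (gen R i) 1 * tens << u >> 1.
  rewrite malgUM.
  have one1 := esym (mulr1 (1 : freeCom R I)).
  exact: etrans (congr1 (tens _) one1) (tensM _ _ _ _).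
have -> (a b p q : freeCom2 R I) : a * b - p * q = (a - p) * b + (b - q) * p.
  by rewrite !mulrBl (mulrC b p) (mulrC q p) addrA subrK.
rewrite wtM wtU.
apply: wt_belowD.
  apply: (wt_belowM (hD i)).
  rewrite -[D << u >>](subrK (tens << u >> 1)).
  apply: wt_belowD; first exact: wt_below_leq IHu.
  exact: wt_below_tens.
rewrite addnC.
apply: (wt_belowM IHu).
by apply: wt_below_tens; rewrite wtU.
Qed.

(* Since the left tensor factors of [D u - u (x) 1] have lower weight than [u],
   the convolution equation [T * phi = 0] can be solved for [T] recursively;
   coassociativity is not used. *)
Lemma convolution_cancel (J : choiceType)
    (D : {lrmorphism freeCom R I -> freeCom2 R I})
    (phi : freeCom R I -> freeCom R J)
    (T : {linear freeCom R I -> freeCom R J}) :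
  phi 1 = 1 ->
  (forall i, wt_below (d i) (D (gen R i) - tens (gen R i) 1)) ->
  (forall x, mulT (tensmap T phi (D x)) = 0) ->
  forall x, T x = 0.
Proof.
move=> phi1 hD hT; pose Z : {linear freeCom R I -> freeCom R J} := \0.
suff TU u : T << u >> = 0 by apply: (malg_ext (f := T) (g := Z)).
have [n] := ubnP (wt u); elim: n u => // n IHn u un.
have := hT << u >>; rewrite -[D << u >>](subrK (tens << u >> 1)).
rewrite linearD /= linearD /=.
rewrite {1}/tensmap linext.unlock big_seq big1 => [|[a b] ab /=]; last first.
  suff -> : T << a >> = 0 by rewrite tens0l scaler0.
  apply: IHn; rewrite -ltnS; apply: leq_trans un; rewrite ltnS ltnNge.
  apply/negP => /(wt_below_leading hD) h.
  by move: ab; rewrite -mcoeff_neq0 h eqxx.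
by rewrite linear0 add0r malg1E tensU tensmapU -malg1E phi1 mulT_tens mulr1.
Qed.

End WeightFiltration.

(** Both [phi \o SI] and [SJ \o phi] are left convolution inverses of [phi], so their difference [T]
    convolves with [phi] to zero and vanishes by [convolution_cancel]. *)
Lemma antipode_morph I J (d : I -> nat)
    (DI : {lrmorphism freeCom R I -> freeCom2 R I})
    (DJ : freeCom R J -> freeCom2 R J)
    (phi : {lrmorphism freeCom R I -> freeCom R J}) SI SJ :
  (forall i, wt_below d (d i) (DI (gen R i) - tens (gen R i) 1)) ->
  (forall x, DJ (phi x) = tensmap phi phi (DI x)) ->
  (forall x, counit (phi x) = counit x) ->
  is_antipode DI SI -> is_antipode DJ SJ -> forall x, phi (SI x) = SJ (phi x).
Proof.
move=> hD phiD phiE aI aJ x; apply/eqP; rewrite -subr_eq0; apply/eqP.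
pose T1 : {linear freeCom R I -> freeCom R J} := phi \o SI.
pose T2 : {linear freeCom R I -> freeCom R J} := SJ \o phi.
pose T : {linear freeCom R I -> freeCom R J} := T1 \- T2.
apply: (convolution_cancel (T := T) (phi := phi) (rmorph1 phi) hD) => {}x.
have -> : tensmap T phi (DI x) = tensmap T1 phi (DI x) - tensmap T2 phi (DI x).
  pose h : {linear freeCom2 R I -> freeCom2 R J} :=
    tensmap T1 phi \- tensmap T2 phi.
  apply: (malg_ext (f := tensmap T phi) (g := h)) => -[a b] /=.
  rewrite !tensmapU /= -[LHS]/(tens_flip _ _) linearB //.
have -> : tensmap T1 phi (DI x) = tensmap phi phi (tensmap SI idfun (DI x)).
  pose h : {linear freeCom2 R I -> freeCom2 R J} :=
    tensmap phi phi \o tensmap SI idfun.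
  apply: (malg_ext (f := tensmap T1 phi) (g := h)) => -[a b] /=.
  by rewrite !tensmapU tensmap_tens.
have -> : tensmap T2 phi (DI x) = tensmap SJ idfun (tensmap phi phi (DI x)).
  pose h : {linear freeCom2 R I -> freeCom2 R J} :=
    tensmap SJ idfun \o tensmap phi phi.
  apply: (malg_ext (f := tensmap T2 phi) (g := h)) => -[a b] /=.
  by rewrite !tensmapU tensmap_tens.
rewrite linearB /= -mulT_morph -phiD.
rewrite (aI x).1 (aJ (phi x)).1 phiE.
have -> : phi (counit x)%:A = (counit x)%:A.
  by rewrite linearZ /=; congr (_ *: _); apply: rmorph1.
exact: subrr.
Qed.

End FreeAlgebras.

(** * Words read off sets of vertices *)

Section Words.
Variables (m n : nat) (dec : 'I_n -> 'I_m.+1).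
Implicit Types (U S J A : {set 'I_n}).

Definition verts U : seq 'I_n := [seq v <- enum 'I_n | v \in U].
Definition word U : seq 'I_m.+1 := [seq dec v | v <- verts U].

Lemma mem_verts U : verts U =i U.
Proof. by move=> v; rewrite mem_filter mem_enum andbT. Qed.

Lemma verts_setT : verts setT = enum 'I_n.
Proof. by apply/all_filterP/allP => v; rewrite in_setT. Qed.

Lemma sorted_verts U : sorted (relpre val ltn) (verts U).
Proof.
apply: sorted_filter; first by move=> ? ? ?; apply: ltn_trans.
by rewrite -sorted_map val_enum_ord iota_ltn_sorted.
Qed.

Lemma verts_sub U S : S \subset U -> verts S = [seq v <- verts U | v \in S].
Proof.
move=> SU; rewrite -filter_predI; apply: eq_filter => v /=.
by case: (boolP (v \in S)) => [/(subsetP SU)->|].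
Qed.

(** Both lists are strictly increasing and have the same members. *)
Lemma verts_min U u : is_min U u -> verts U = u :: verts (U :\ u).
Proof.
move=> /andP[uU /forallP umin].
apply: (irr_sorted_eq (leT := relpre val ltn)).
- by move=> ? ? ?; apply: ltn_trans.
- by move=> ?; rewrite /= ltnn.
- exact: sorted_verts.
- rewrite /= path_sortedE; last by move=> ? ? ?; apply: ltn_trans.
  rewrite sorted_verts andbT; apply/allP => v; rewrite mem_verts in_setD1.
  move=> /andP[vu vU]; rewrite /= ltn_neqAle (implyP (umin v) vU) andbT.
  by rewrite eq_sym.
move=> v; rewrite mem_verts in_cons mem_verts in_setD1.
by case: eqVneq => [->|].
Qed.

Lemma exists_min U : U != set0 -> exists u, is_min U u.
Proof.
case/set0Pn => u uU; case: (arg_minnP val uU) => v vU vmin.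
by exists v; apply/andP; split=> //; apply/forallP => w; apply/implyP/vmin.
Qed.

Lemma is_minD1 U u v : is_min U u -> v \in U :\ u -> (u < v)%N.
Proof.
move=> /andP[_ /forallP/(_ v)/implyP h]; rewrite in_setD1 => /andP[vu /h].
by rewrite leq_eqVlt => /orP[/eqP/val_inj uv|//]; rewrite uv eqxx in vu.
Qed.

Lemma min_uniq U u v : is_min U u -> is_min U v -> u = v.
Proof.
move=> /andP[uU /forallP hu] /andP[vU /forallP hv]; apply/val_inj/eqP.
by rewrite eqn_leq (implyP (hu v) vU) (implyP (hv u) uU).
Qed.

Lemma is_minU1 U S u : is_min U u -> S \subset U :\ u -> is_min (u |: S) u.
Proof.
move=> uU SU; rewrite /is_min setU11 /=; apply/forallP => v; apply/implyP.
rewrite in_setU1 => /orP[/eqP->//|/(subsetP SU) vU].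
exact/ltnW/(is_minD1 uU).
Qed.

(** The induction hypothesis covers every subset of [U :\ u], because extracting a set with minimum
    [u] leaves [U :\ u :\: S]. *)
Lemma set_min_ind (P : {set 'I_n} -> Prop) :
  P set0 ->
  (forall U u, is_min U u -> (forall S, S \subset U :\ u -> P S) -> P U) ->
  forall U, P U.
Proof.
move=> P0 PS U; have [k] := ubnP #|U|; elim: k U => // k IHk U Uk.
have [->//|/exists_min[u uU]] := eqVneq U set0.
apply: (PS U u uU) => S SU; apply: IHk.
apply: leq_ltn_trans (subset_leq_card SU) _.
by move: Uk; rewrite (cardsD1 u) (andP uU).1.
Qed.

Lemma subsetD1_notin U S u : S \subset U :\ u -> u \notin S.
Proof. by rewrite subsetD1 => /andP[]. Qed.

Lemma big_subset_D1 (V : nmodType) U u (F : {set 'I_n} -> V) : u \in U ->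
  \sum_(S : {set 'I_n} | S \subset U) F S =
  \sum_(S : {set 'I_n} | S \subset U :\ u) F S +
  \sum_(S : {set 'I_n} | S \subset U :\ u) F (u |: S).
Proof.
move=> uU; rewrite (bigID (fun S : {set 'I_n} => u \in S)) /= addrC.
congr (_ + _); first by apply: eq_bigl => S; rewrite subsetD1.
rewrite (reindex_onto (fun S => u |: S) (fun S => S :\ u)) /=; last first.
  by move=> S /andP[_ uS]; rewrite setD1K.
apply: eq_bigl => S; rewrite setU11 andbT subUset sub1set uU subsetD1.
congr (_ && _); apply/eqP/idP => [<-|uS]; first by rewrite setD11.
by rewrite setU1K.
Qed.

Lemma word_min U u : is_min U u -> word U = dec u :: word (U :\ u).
Proof. by rewrite /word => /verts_min ->. Qed.

Lemma word0 : word set0 = [::].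
Proof. by rewrite /word /verts (eq_filter (in_set0 (T := _))) filter_pred0. Qed.

Lemma tensmap_crd (R : comNzRingType) (K L : choiceType)
    (f : {malg R[hcoord m]} -> {malg R[K]})
    (g : {malg R[hcoord m]} -> {malg R[L]}) i w j w' :
  tensmap f g (tens (crd R i w) (crd R j w')) =
  tens (f (crd R i w)) (g (crd R j w')).
Proof. by rewrite tensU tensmapU. Qed.

(** * Deshuffling as a sum over subsets *)

Section Shuffle.
Variable R : comNzRingType.

(** The set [S] collects the vertices whose letters go to the right factor. Subsets without [u] come
    from [theta_k (x) id], subsets containing [u] from [id (x) theta_k]. *)
Lemma shuffle_word j i U :
  shuffle j (crd R i (word U)) =
  \sum_(S : {set 'I_n} | S \subset U)
     tens (crd R i (word (U :\: S))) (crd R j (word S)).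
Proof.
elim/set_min_ind: U => [|U u uU IHU].
  rewrite (big_pred1 set0) => [|S]; last by rewrite /= subset0.
  by rewrite setD0 word0 shuffle_nil.
have uinU : u \in U by case/andP: uU.
rewrite (word_min uU) -(thetaU _ (dec u)) shuffle_theta (IHU _ (subxx _)).
symmetry; apply: etrans (big_subset_D1 _ uinU) _.
rewrite !linear_sum; congr (_ + _); apply: eq_bigr => S SU /=.
  rewrite [RHS]tensmap_crd thetaU (@word_min (U :\: S) u); last first.
    case/andP: uU => _ /forallP h; rewrite /is_min inE uinU.
    rewrite (subsetD1_notin SU) /=; apply/forallP => v.
    by apply/implyP; rewrite inE => /andP[_]; apply/implyP.
  by rewrite !setDDl setUC.
rewrite [RHS]tensmap_crd thetaU (@word_min (u |: S) u); last first.
  exact: is_minU1 uU SU.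
by rewrite (setU1K (subsetD1_notin SU)) (setDDl U).
Qed.
End Shuffle.

(* Sets with a label on each, encoded as a partial function: the members of the
   family are the sets at which the function is defined. *)
Definition lfamily : finType := {ffun {set 'I_n} -> option 'I_m}.
Implicit Types g : lfamily.

Definition members g : {set {set 'I_n}} := [set J | isSome (g J)].
(** Used with [Some j] to add a labelled set to a family, and with [None] to remove one. *)
Definition upd g A o : lfamily := [ffun J => if J == A then o else g J].

Definition adm J := [exists w, is_min J w && (dec w == x0)].
(** In contrast to [extraction], the empty family is allowed, and the members are confined to [U] so
    that the recursion can remove vertices. *)
Definition extractible U g :=
  [&& trivIset (members g), [forall J in members g, adm J]
    & cover (members g) \subset U].

Definition no_extraction : lfamily := [ffun => None].

(** From here to [nonmin]: counterparts, for partial functions and relative to [U], of the vertex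
    filter of [contract], of [redeco], and of the decorations of [contract] and [extracted]. *)
Definition kept g v :=
  (v \notin cover (members g)) || [exists J in members g, is_min J v].
Definition letter g v :=
  if [pick J | g J && is_min J v] is Some J then oapp xl (dec v) (g J)
  else dec v.
Definition rest U g := [seq letter g v | v <- verts U & kept g v].
Definition nonmin J :=
  [seq dec v | v <- enum 'I_n & (v \in J) && ~~ is_min J v].

Lemma adm_neq0 J : adm J -> J != set0.
Proof.
by case/existsP => w /andP[/andP[wJ _] _]; apply/set0Pn; exists w.
Qed.

Lemma members_sub U g J : extractible U g -> g J -> J \subset U.
Proof.
case/and3P => _ _ sub gJ; apply: subset_trans sub; apply: bigcup_sup.
by rewrite inE.
Qed.

Lemma members_upd g A o : members (upd g A (Some o)) = A |: members g.
Proof. by apply/setP => J; rewrite !inE ffunE; case: eqVneq. Qed.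

Lemma coverU1 A (P : {set {set 'I_n}}) : cover (A |: P) = A :|: cover P.
Proof. by rewrite /cover bigcup_setU big_set1. Qed.

Lemma members_no_extraction : members no_extraction = set0.
Proof. by apply/setP => J; rewrite !inE ffunE. Qed.

Lemma rest_no_extraction U : rest U no_extraction = word U.
Proof.
have none J : no_extraction J = None by rewrite ffunE.
rewrite /rest /word (eq_filter (a2 := predT)) => [|v].
  rewrite filter_predT; apply: eq_map => v; rewrite /letter.
  by case: pickP => // J; rewrite none.
by rewrite /kept members_no_extraction /cover big_set0 in_set0.
Qed.

(** Admissible sets are nonempty, so none of them lies in [set0]. *)
Lemma extractible_set0 g : extractible set0 g = (g == no_extraction).
Proof.
apply/idP/eqP => [ex|->].
  apply/ffunP => J; rewrite ffunE; case gJ: (g J) => [j|] //.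
  have gJ' : g J by rewrite gJ.
  case/and3P: (ex) => _ /forallP/(_ J); rewrite inE gJ' /= => /adm_neq0.
  by have := members_sub ex gJ'; rewrite subset0 => ->.
rewrite /extractible members_no_extraction /cover big_set0 subxx andbT.
apply/andP; split.
  by apply/trivIsetP => A B; rewrite inE.
by apply/forallP => J; rewrite inE.
Qed.

Lemma extractibleS U U' g : U \subset U' -> extractible U g -> extractible U' g.
Proof.
by move=> UU' /and3P[triv ad /subset_trans/(_ UU') sub]; apply/and3P.
Qed.

Lemma extractibleD1 U u g :
  extractible (U :\ u) g = extractible U g && (u \notin cover (members g)).
Proof. by rewrite /extractible subsetD1 !andbA. Qed.

(** * Adding or removing the extracted set that contains the least vertex *)

Section Split.
Variables (U : {set 'I_n}) (u : 'I_n) (uU : is_min U u).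

(** The member containing [u] lies in [U], so [u] is its minimum too, and the minimum of an
    admissible set is white. *)
Lemma extractible_white g :
  extractible U g -> u \in cover (members g) -> dec u = x0.
Proof.
move=> ex /bigcupP[J]; rewrite inE => gJ uJ.
case/and3P: (ex) => _ /forallP/(_ J); rewrite inE gJ /= => /existsP[w].
case/andP=> wJ /eqP <- _; congr dec; apply: min_uniq wJ.
rewrite /is_min uJ /=; apply/forallP => v; apply/implyP => vJ.
case/andP: uU => _ /forallP/(_ v)/implyP; apply.
exact: (subsetP (members_sub ex gJ)).
Qed.

Lemma rest_D1 g :
  u \notin cover (members g) -> rest U g = dec u :: rest (U :\ u) g.
Proof.
move=> uc; rewrite /rest (verts_min uU) /= {1}/kept uc; congr (_ :: _).
rewrite /letter; case: pickP => // J /andP[gJ /andP[uJ _]].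
by case/negP: uc; apply/bigcupP; exists J; rewrite ?inE.
Qed.

Section Update.
Variables (S : {set 'I_n}) (j : 'I_m) (g : lfamily).
Hypotheses (SU : S \subset U :\ u) (exg : extractible (U :\ u :\: S) g).

Lemma fresh_min v : is_min (u |: S) v = (v == u).
Proof.
have uA := is_minU1 uU SU; apply/idP/eqP => [h|->//].
exact: min_uniq h uA.
Qed.

Lemma fresh_disjoint J : g J -> [disjoint u |: S & J].
Proof.
move=> gJ; have /subsetP JU := members_sub exg gJ.
rewrite disjoint_sym disjoints_subset; apply/subsetP => v /JU.
by rewrite !inE negb_or => /and3P[-> -> _].
Qed.

(** Otherwise the nonempty set [u |: S] would be disjoint from itself. *)
Lemma fresh_None : g (u |: S) = None.
Proof.
case gA: (g (u |: S)) => [k|] //.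
have := @fresh_disjoint (u |: S); rewrite gA => /(_ isT).
by rewrite -setI_eq0 setIid => /eqP/setP/(_ u); rewrite !inE eqxx.
Qed.

Lemma kept_upd v : v \in U :\ u ->
  kept (upd g (u |: S) (Some j)) v = (v \notin S) && kept g v.
Proof.
rewrite in_setD1 => /andP[vu _].
rewrite /kept members_upd coverU1 in_setU in_setU1 (negbTE vu) /=.
have -> : [exists J in (u |: S) |: members g, is_min J v] =
          [exists J in members g, is_min J v].
  apply/existsP/existsP => -[J]; last first.
    by case/andP => gJ Jv; exists J; rewrite in_setU1 gJ orbT.
  rewrite in_setU1; case: eqVneq => [->|_] /=; last by exists J.
  by rewrite fresh_min (negbTE vu).
case: (boolP (v \in S)) => //= vS; apply/negbTE/negP => /existsP[J /andP[]].
rewrite inE => /fresh_disjoint /pred0P/(_ v) /=; rewrite !inE vS orbT /=.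
by move=> vJ /andP[]; rewrite vJ.
Qed.

Lemma letter_upd v : v \notin u |: S ->
  letter (upd g (u |: S) (Some j)) v = letter g v.
Proof.
move=> vA; have nA J : is_min J v -> J != u |: S.
  by case/andP => vJ _; apply: contra vA => /eqP <-.
rewrite /letter (eq_pick (Q := fun J => g J && is_min J v)) => [|J].
  by case: pickP => // J /andP[_ /nA nJ]; rewrite ffunE (negbTE nJ).
rewrite ffunE; case: (boolP (is_min J v)) => [/nA/negbTE->|] //.
by rewrite !andbF.
Qed.

Lemma letter_upd_fresh : letter (upd g (u |: S) (Some j)) u = xl j.
Proof.
rewrite /letter; case: pickP => [J|/(_ (u |: S))]; last first.
  by rewrite ffunE eqxx fresh_min eqxx.
rewrite ffunE; case: eqVneq => [//|_] /andP[/fresh_disjoint/pred0P/(_ u)].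
by rewrite /= !inE eqxx /= => uJ /andP[]; rewrite uJ.
Qed.

(** As minimum of the new set, [u] is kept and relabelled [xl j]. The vertices of [S] are covered
    without being minimal, hence dropped; by disjointness the new set affects no other vertex. *)
Lemma rest_upd :
  rest U (upd g (u |: S) (Some j)) = xl j :: rest (U :\ u :\: S) g.
Proof.
rewrite /rest (verts_min uU) /=.
have -> : kept (upd g (u |: S) (Some j)) u.
  apply/orP; right; apply/existsP; exists (u |: S).
  by rewrite members_upd setU11 fresh_min eqxx.
rewrite /= letter_upd_fresh; congr (_ :: _).
(* Both sides become filters of [verts (U :\ u)], so that the predicates and then the letters can be
   compared. *)
rewrite (verts_sub (subsetDl _ S)) -[in RHS]filter_predI.
rewrite (eq_in_filter (a2 := predI (kept g) [in U :\ u :\: S])) => [|v].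
  apply/eq_in_map => v; rewrite mem_filter /= => /andP[/andP[_ vD] _].
  apply: letter_upd; move: vD; rewrite !inE => /and3P[vS vu _].
  by rewrite negb_or vu.
by rewrite mem_verts => vU; rewrite kept_upd //= andbC in_setD vU andbT.
Qed.

Lemma nonmin_fresh : nonmin (u |: S) = word S.
Proof.
rewrite /nonmin /word; congr map; apply: eq_filter => v.
rewrite fresh_min in_setU1; case: eqVneq => [->|_] /=; last by rewrite andbT.
by rewrite (negbTE (subsetD1_notin SU)).
Qed.

Lemma cover_extraction_fresh :
  u \in cover (members (upd g (u |: S) (Some j))).
Proof. by rewrite members_upd coverU1 in_setU setU11. Qed.

(** The added set is recovered as the block of [u], which makes the update invertible. *)
Lemma pblock_fresh :
  extractible U (upd g (u |: S) (Some j)) ->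
  pblock (members (upd g (u |: S) (Some j))) u = u |: S.
Proof.
move=> /and3P[triv _ _]; apply: def_pblock triv _ (setU11 _ _).
by rewrite members_upd setU11.
Qed.

Lemma extractible_upd : dec u = x0 ->
  extractible U (upd g (u |: S) (Some j)).
Proof.
move=> du; have uin : u \in U by case/andP: uU.
have SU' : S \subset U by apply: subset_trans SU (subsetDl _ _).
case/and3P: (exg) => triv /forallP ad sub; rewrite /extractible members_upd.
apply/and3P; split.
- apply: (proj1 (trivIsetU1 _ triv _)) => [J|].
    by rewrite inE => /fresh_disjoint.
  by apply/negP => /(implyP (ad _)) /adm_neq0; rewrite eqxx.
- apply/forallP => J; apply/implyP; rewrite in_setU1 => /orP[/eqP->|].
    by apply/existsP; exists u; rewrite fresh_min du !eqxx.
  by move/(implyP (ad J)).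
- rewrite coverU1 !subUset sub1set uin SU' /=; apply: subset_trans sub _.
  exact: subset_trans (subsetDl _ _) (subsetDl _ _).
Qed.

End Update.

(** The converse of [extractible_upd]: once the block [B] of [u] is removed, disjointness confines
    the other members to the vertices outside [B]. *)
Lemma extractible_split g (B := pblock (members g) u) :
  extractible U g -> u \in cover (members g) ->
  [/\ u |: B :\ u = B, B :\ u \subset U :\ u, isSome (g B)
    & extractible (U :\ u :\: (B :\ u)) (upd g B None)].
Proof.
move=> ex uc; have uB : u \in B by rewrite mem_pblock.
have gB : g B by have := pblock_mem uc; rewrite inE.
split=> //; first by rewrite setD1K.
  exact/setSD/(members_sub ex gB).
case/and3P: (ex) => triv /forallP ad sub.
have mE : members (upd g B None) = members g :\ B.
  by apply/setP => J; rewrite !inE ffunE; case: eqVneq.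
rewrite /extractible mE; apply/and3P; split.
- exact: trivIsetS (subsetDl _ _) triv.
- by apply/forallP => J; apply/implyP => /setD1P[_ /(implyP (ad J))].
apply/bigcupsP => J /setD1P[JB]; rewrite inE => gJ.
have JU := members_sub ex gJ; apply/subsetP => v vJ.
have vB : v \notin B.
  have /trivIsetP/(_ J B) := triv; rewrite !inE gJ gB => /(_ isT isT JB).
  by move=> /pred0P/(_ v) /=; rewrite vJ => /= ->.
rewrite !inE (subsetP JU) // (negbTE vB) andbF andbT /=.
by apply: contraNneq vB => ->.
Qed.

End Split.

(** * The coaction on words as a sum over labelled families *)

Section Coaction.
Variable R : comNzRingType.

(** The product runs over all vertex sets, with factor 1 where [g] is undefined, so that changing
    one value of [g] changes one factor. *)
Definition extract g : freeCom R (hcoord m) :=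
  \prod_(J : {set 'I_n}) oapp (fun j => gen R (j, nonmin J)) 1 (g J).

Lemma theta_mul_tens j i w (u : {cmonom (hcoord m)}) k w' :
  theta_mul j (tens (tens (crd R i w) << u >>) (crd R k w')) =
  tens (crd R i (xl j :: w)) (<< u >> * gen R ((k, w') : hcoord m)).
Proof. by rewrite !tensU /theta_mul linextU /inclV linextU thetaU. Qed.

Lemma theta_tens (k : 'I_m.+1) i w (u : {cmonom (hcoord m)}) :
  tensmap (theta k) idfun (tens (crd R i w) << u >>) =
  tens (crd R i (k :: w)) << u >>.
Proof. by rewrite tensU tensmapU thetaU. Qed.

Lemma extract_no_extraction : extract no_extraction = 1.
Proof. by rewrite /extract big1 // => J _; rewrite ffunE. Qed.

(** Maps such as [theta_mul] are prescribed on basis elements; to evaluate them, the right tensor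
    factor has to be exhibited as a single monomial. *)
Lemma extract_monomial g : exists u : {cmonom (hcoord m)}, extract g = << u >>.
Proof.
rewrite /extract; elim/big_rec: _ => [|J x _ [u ->]]; first by exists mone.
case: (g J) => [j|] /=; last by exists u; rewrite mul1r.
by exists (mmul (ucm ((j, nonmin J) : hcoord m)) u); rewrite malgUM.
Qed.

Lemma extract_upd U u S j g : is_min U u -> S \subset U :\ u ->
  extractible (U :\ u :\: S) g ->
  extract (upd g (u |: S) (Some j)) = extract g * gen R (j, word S).
Proof.
move=> uU SU ex; pose A := u |: S; pose h := upd g A (Some j).
pose x k J : freeCom R (hcoord m) := oapp (fun k => gen R (k, nonmin J)) 1 k.
have E g' : extract g' = x (g' A) A * \prod_(J | J != A) x (g' J) J.
  exact: (bigD1 A).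
have -> : extract h = gen R (j, word S) * \prod_(J | J != A) x (g J) J.
  rewrite E ffunE eqxx {1}/x /= (nonmin_fresh uU SU); congr (_ * _).
  by apply: eq_bigr => J JA; rewrite ffunE (negbTE JA).
have -> : extract g = \prod_(J | J != A) x (g J) J.
  by rewrite E (fresh_None ex) {1}/x /= mul1r.
exact: mulrC.
Qed.

Lemma tdelta_word i U :
  tdelta (crd R i (word U)) =
  \sum_(g : lfamily | extractible U g) tens (crd R i (rest U g)) (extract g).
Proof.
elim/set_min_ind: U => [|U u uU IHU].
  rewrite (big_pred1 no_extraction); last exact: extractible_set0.
  by rewrite rest_no_extraction extract_no_extraction word0 tdelta_nil.
rewrite (word_min uU) tdeltaU /=.
rewrite (bigID (fun g => u \in cover (members g))) /= addrC; congr (_ + _).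
  rewrite (IHU _ (subxx _)) linear_sum; apply: eq_big => g.
    exact: extractibleD1.
  rewrite extractibleD1 => /andP[ex uc].
  have [q qE] := extract_monomial g.
  rewrite qE [LHS]theta_tens -qE.
  by rewrite (rest_D1 uU uc).
(* If [u] is not white, the recursion has no second term and no extractible family covers [u]. *)
case: eqP => [du|du]; last first.
  rewrite big_pred0 // => g; apply/negP => /andP[ex uc].
  exact/du/(extractible_white uU ex uc).
pose F g := tens (crd R i (rest U g)) (extract g).
(* The left word of the deshuffling is read off [U :\ u :\: S], to which the induction hypothesis
   applies; the right word is that of the set extracted at [u]. *)
transitivity (\sum_(j < m) \sum_(S : {set 'I_n} | S \subset U :\ u)
    \sum_(g | extractible (U :\ u :\: S) g) F (upd g (u |: S) (Some j))).
  apply: eq_bigr => j _; rewrite shuffle_word !linear_sum.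
  apply: eq_bigr => S SU /=; rewrite tensmap_crd IHU ?subsetDl //.
  rewrite tens_suml linear_sum; apply: eq_bigr => g ex /=.
  have [q qE] := extract_monomial g.
  rewrite qE theta_mul_tens -qE /F.
  by rewrite (rest_upd uU j SU ex) (extract_upd j uU SU ex).
pose Q (q : {set 'I_n} * lfamily) :=
  (q.1 \subset U :\ u) && extractible (U :\ u :\: q.1) q.2.
pose G j (q : {set 'I_n} * lfamily) := F (upd q.2 (u |: q.1) (Some j)).
transitivity (\sum_(j < m) \sum_(q | Q q) G j q).
  apply: eq_bigr => j _.
  exact: (pair_big_dep (fun S => S \subset U :\ u)
    (fun S => extractible (U :\ u :\: S)) (fun S g => G j (S, g))).
apply: etrans (pair_big_dep xpredT (fun=> Q) G) _; symmetry.
(* The map [h] adds the set [u |: S] with label [j]. Its inverse [h'] reads [S] and [j] off the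
   block of [u]; it is partial because a family may be undefined at that block. *)
pose h (p : 'I_m * ({set 'I_n} * lfamily)) :=
  upd p.2.2 (u |: p.2.1) (Some p.1).
pose h' g := let B := pblock (members g) u in
  omap (fun j => (j, (B :\ u, upd g B None))) (g B).
rewrite (reindex_omap h h') => [|g /andP[ex uc]]; last first.
  have [uBE _ gB _] := extractible_split ex uc.
  rewrite /h' /h; case gBE: (g _) gB => [j|] //= _; congr Some.
  apply/ffunP => J; rewrite !ffunE uBE; case: eqVneq => [->|//].
  by rewrite gBE.
apply: eq_big => [[j [S g]]|[j [S g]] _ //]; rewrite /h /Q /=.
apply/idP/idP => [/andP[/andP[ex uc]]|/andP[SU ex]].
  have [uBE BU gB exB] := extractible_split ex uc.
  rewrite /h'; case gBE: (upd _ _ _ _) gB => [k|] //= _ /eqP[_ SE gE].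
  by rewrite SE in BU exB; rewrite gE in exB; rewrite BU exB.
(* Here [h'] undoes [h]: the block of [u] is the added set, and resetting it to [None] restores [g],
   which was undefined there. *)
have exU := extractible_upd uU j SU ex du.
rewrite exU (cover_extraction_fresh u S j g) /h' (pblock_fresh exU).
rewrite ffunE eqxx /= (setU1K (subsetD1_notin SU)); apply/eqP.
congr (Some (_, (_, _))); apply/ffunP => J; rewrite !ffunE.
by case: eqVneq => // ->; rewrite (fresh_None ex).
Qed.

End Coaction.
End Words.

(** * From extractions of a circle tree to labelled families *)

Section CircleTreeCoproduct.
Variables (m : nat) (c : rct m).
Local Notation n := (nv c).
Local Notation dec := (@deco m c).
Implicit Types (P : {set {set 'I_n}}) (g : lfamily m n).

Lemma word_setT : word dec [set: 'I_n] = vdeco c.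
Proof.
by rewrite /word verts_setT map_tnth_enum.
Qed.

(** The empty family is set apart because its term is the separate summand [c (x) 1] of the
    coproduct. *)
Lemma extraction_members g :
  extractible dec [set: 'I_n] g && (g != no_extraction m n) =
  extraction (members g).
Proof.
rewrite /extractible /extraction subsetT andbT [RHS]andbC; congr (_ && _).
congr (~~ _); apply/eqP/eqP => [->|g0].
  by apply/setP => J; rewrite !inE ffunE.
apply/ffunP => J; rewrite ffunE; move/setP/(_ J): g0; rewrite !inE.
by case: (g J).
Qed.

Section Labelling.
Variables (P : {set {set 'I_n}}) (l : labelling P).

(** Turns a labelling, whose type depends on [P], into the partial function with domain [P]. *)
Definition family_of : lfamily m n := [ffun J => omap l (insub J)].

Lemma family_ofE (J : {J : {set 'I_n} | J \in P}) :
  family_of (val J) = Some (l J).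
Proof. by rewrite ffunE valK. Qed.

Lemma members_family_of : members family_of = P.
Proof.
by apply/setP => J; rewrite inE ffunE; case: insubP => [J' -> _|/negbTE->].
Qed.

(** Disjoint sets cannot share the minimum [v], so both choices pick the same set. *)
Lemma letter_family_of v : trivIset P -> letter dec family_of v = redeco l v.
Proof.
move=> triv; rewrite /letter /redeco; case: pickP => [J /andP[lJ Jv]|noJ].
  have JP : J \in P by rewrite -members_family_of inE.
  case: pickP => [K Kv|/(_ (Sub J JP))]; last by rewrite SubK Jv.
  have -> : J = val K; last by rewrite family_ofE.
  have /trivIsetP/(_ J (val K) JP (valP K)) := triv; case: eqVneq => // _.
  move=> /(_ isT)/pred0P/(_ v) /=.
  by rewrite (andP Jv).1 (andP Kv).1.
case: pickP => // K Kv; have := noJ (val K).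
by rewrite family_ofE Kv.
Qed.

Lemma contract_family_of :
  trivIset P -> vdeco (contract l) = rest dec [set: 'I_n] family_of.
Proof.
move=> triv; rewrite /rest verts_setT /kept members_family_of.
by apply/eq_map => v; rewrite letter_family_of.
Qed.

Lemma extract_family_of (R : comNzRingType) :
  extract dec R family_of =
  \prod_(J : {J : {set 'I_n} | J \in P})
     gen R (rct_pair (extracted (val J) (l J)) : hcoord m).
Proof.
pose F J : freeCom R (hcoord m) :=
  oapp (fun j => gen R (j, nonmin dec J)) 1 (family_of J).
transitivity (\prod_(J in P) F J).
  rewrite big_mkcond; apply: eq_bigr => J _; rewrite /F ffunE.
  by case: insubP => [K -> _|/negbTE->].
rewrite big_sub; apply: eq_bigr => J _.
by rewrite /F family_ofE.
Qed.

End Labelling.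

(** Families are grouped by their set of members; over a fixed [P], [family_of] is a bijection from
    the labellings of [P]. *)
Lemma sum_extractions (V : nmodType) (F : lfamily m n -> V) :
  \sum_(P : {set {set 'I_n}} | extraction P)
    \sum_(l : labelling P) F (family_of l) =
  \sum_(g | extractible dec [set: 'I_n] g && (g != no_extraction m n)) F g.
Proof.
rewrite (partition_big (@members m n) (@extraction m c)) => [|g]; last first.
  by rewrite extraction_members.
apply: eq_bigr => P exP; symmetry.
(* The label [rlabel c] is only a default: a family whose members form [P] is defined on all of
   [P]. *)
pose lab g : labelling P := [ffun J => odflt (rlabel c) (g (val J))].
rewrite (reindex_onto (@family_of P) lab) => [|g /andP[_ /eqP gP]].
  apply: eq_bigl => l; rewrite extraction_members members_family_of exP eqxx /=.
  by apply/eqP/ffunP => J; rewrite ffunE family_ofE.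
apply/ffunP => J; rewrite ffunE; case: insubP => [K JP <-|JP] /=.
  rewrite ffunE; have : val K \in members g by rewrite gP (valP K).
  by rewrite inE; case: (g _).
by move: JP; rewrite -gP inE; case: (g J).
Qed.

End CircleTreeCoproduct.

(** * The degree of circle trees decreases under contraction *)

Section Weight.
Variable m : nat.

Definition letter_weight (k : 'I_m.+1) : nat := (k == x0).+1.
(** This is the degree of the circle tree, the outer successor counting the root. *)
Definition rct_weight (c : rct m) : nat :=
  (\sum_(k <- vdeco c) letter_weight k).+1.

(** Minima of extracted sets turn from white to black, losing one unit of weight, and every other
    vertex keeps its weight or disappears. One extracted set exists, so the loss is strict. *)
Lemma contract_weight c (P : {set {set 'I_(nv c)}}) (l : labelling P) :
  extraction P -> (rct_weight (contract l) < rct_weight c)%N.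
Proof.
case/and3P=> P0 _ /forallP ad; have /set0Pn[J JP] := P0.
have /existsP[w /andP[wJ /eqP dw]] := implyP (ad J) JP.
have lxl j : letter_weight (xl j : 'I_m.+1) = 1%N by [].
have lw v : (letter_weight (redeco l v) <= letter_weight (deco v))%N.
  by rewrite /redeco; case: pickP.
rewrite /rct_weight ltnS big_map big_filter big_enum_cond /= big_mkcond.
have -> : (\sum_(k <- vdeco c) letter_weight k =
    \sum_(v < nv c) letter_weight (deco v))%N.
  by rewrite (big_tnth _ _ (vdeco c)).
(* The strict inequality is placed at the white minimum [w] of one chosen member [J]. *)
rewrite (bigD1 w) //= [X in (_ < X)%N](bigD1 w) //= -addSn; apply: leq_add.
  rewrite {2}/letter_weight dw eqxx ltnS; case: ifP => // _.
  rewrite /redeco; case: pickP => [K _|/(_ (Sub J JP))].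
    by rewrite lxl.
  by rewrite SubK wJ.
by apply: leq_sum => v _; case: ifP.
Qed.

End Weight.

(** * The renaming of generators and its compatibility with the coproducts *)

Section Isomorphism.
Variables (R : comNzRingType) (m : nat).

Definition to_coord : freeCom R (rct m) -> freeCom R (hcoord m) :=
  algext (fun c => gen R (rct_pair c : hcoord m)).
Definition of_coord : freeCom R (hcoord m) -> freeCom R (rct m) :=
  algext (fun a => gen R (pair_rct a)).
HB.instance Definition _ := GRing.LRMorphism.on to_coord.
HB.instance Definition _ := GRing.LRMorphism.on of_coord.

Lemma to_coord_gen c : to_coord (gen R c) = gen R (rct_pair c : hcoord m).
Proof. exact: algext_gen. Qed.

Lemma of_coord_gen a : of_coord (gen R a) = gen R (pair_rct a).
Proof. exact: algext_gen. Qed.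

Lemma to_coord_bij : bijective to_coord.
Proof.
exists of_coord.
  pose f : {lrmorphism freeCom R (rct m) -> freeCom R (rct m)} :=
    of_coord \o to_coord.
  apply: (freeCom_ext (f := f) (g := idfun)) => c /=.
  by rewrite to_coord_gen of_coord_gen rct_pairK.
pose f : {lrmorphism freeCom R (hcoord m) -> freeCom R (hcoord m)} :=
  to_coord \o of_coord.
apply: (freeCom_ext (f := f) (g := idfun)) => a /=.
by rewrite of_coord_gen to_coord_gen; case: a.
Qed.

Lemma tensmap_incl_tens i w (u : {cmonom (hcoord m)}) :
  tensmap (@inclV R m) idfun (tens (crd R i w) << u >>) =
  tens (gen R ((i, w) : hcoord m)) << u >>.
Proof. by rewrite tensU tensmapU /inclV linextU. Qed.

(** By [tdelta_word] on the set of all vertices, the right-hand side is a sum over families. The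
    empty one gives [c (x) 1], the others match the extractions, and [1 (x) c] is common to both
    sides. *)
Lemma to_coord_coprod_gen c :
  tensmap to_coord to_coord (rct_coprod_gen R c) =
  crd_coprod_gen R (rct_pair c : hcoord m).
Proof.
pose T (g : lfamily m (nv c)) : freeCom2 R (hcoord m) :=
  tens (gen R ((rlabel c, rest (@deco m c) [set: 'I_(nv c)] g) : hcoord m))
       (extract (@deco m c) R g).
pose dec := @deco m c.
have -> : crd_coprod_gen R (rct_pair c : hcoord m) =
    \sum_(g | extractible dec [set: 'I_(nv c)] g) T g +
    tens 1 (gen R (rct_pair c : hcoord m)).
  rewrite /crd_coprod_gen -/(crd R (rlabel c) (vdeco c)) -word_setT tdelta_word.
  congr (_ + _); rewrite linear_sum; apply: eq_bigr => g _ /=.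
  have [q qE] := extract_monomial (@deco m c) R g.
  by rewrite /T qE; exact: tensmap_incl_tens.
have -> : rct_coprod_gen R c = tens (gen R c) 1 + tens 1 (gen R c) +
    \sum_(P : {set {set 'I_(nv c)}} | extraction P) \sum_(l : labelling P)
      tens (gen R (contract l))
           (\prod_(J : {J : {set 'I_(nv c)} | J \in P})
              gen R (extracted (val J) (l J))) by [].
have toT x y : tensmap to_coord to_coord (tens x y) =
    tens (to_coord x) (to_coord y).
  exact: tensmap_tens.
have to1 : to_coord 1 = 1 by exact: rmorph1.
have tD x y : tensmap to_coord to_coord (x + y) =
    tensmap to_coord to_coord x + tensmap to_coord to_coord y by exact: linearD.
have E1 : tensmap to_coord to_coord (tens (gen R c) 1) =
    tens (gen R (rct_pair c : hcoord m)) 1.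
  exact: etrans (toT _ _) (congr2 _ (to_coord_gen c) to1).
have E2 : tensmap to_coord to_coord (tens 1 (gen R c)) =
    tens 1 (gen R (rct_pair c : hcoord m)).
  exact: etrans (toT _ _) (congr2 _ to1 (to_coord_gen c)).
apply: etrans (tD _ _) _.
apply: etrans (congr1 (fun x => x + _) (etrans (tD _ _) (congr2 +%R E1 E2))) _.
rewrite addrAC; apply: (congr1 (fun x => x + _)).
have no_ex : extractible dec [set: 'I_(nv c)] (no_extraction m (nv c)).
  by apply: extractibleS (subsetT set0) _; rewrite extractible_set0.
have Tno : T (no_extraction m (nv c)) = tens (gen R (rct_pair c : hcoord m)) 1.
  apply: (congr2 (@tens _ _ _)); last exact: extract_no_extraction.
  rewrite rest_no_extraction word_setT.
  exact: erefl.
apply: etrans _ (esym (bigD1 _ no_ex)); rewrite Tno.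
apply: (congr1 (fun x => _ + x)).
rewrite -sum_extractions linear_sum; apply: eq_bigr => P exP /=.
rewrite linear_sum; apply: eq_bigr => l _ /=.
rewrite toT to_coord_gen /T extract_family_of.
have triv : trivIset P by case/and3P: exP.
rewrite -contract_family_of //; congr tens.
apply: etrans (rmorph_prod to_coord _ _ _) _; apply: eq_bigr => J _.
exact: to_coord_gen.
Qed.

End Isomorphism.

Theorem theorem4p6 (R : realType) (m : nat) (m_ge1 : (1 <= m)%N) :
  hopf_isomorphic (@rct_coprod R m) (@crd_coprod R m).
Proof.
pose phi : {lrmorphism freeCom R (rct m) -> freeCom R (hcoord m)} :=
  @to_coord R m.
pose DI : {lrmorphism freeCom R (rct m) -> freeCom2 R (rct m)} :=
  algext (@rct_coprod_gen R m).
pose DJ : {lrmorphism freeCom R (hcoord m) -> freeCom2 R (hcoord m)} :=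
  algext (@crd_coprod_gen R m).
have phig c : phi (gen R c) = gen R (rct_pair c : hcoord m).
  exact: to_coord_gen.
have phiD x : DJ (phi x) = tensmap phi phi (DI x).
  pose f : {lrmorphism freeCom R (rct m) -> freeCom2 R (hcoord m)} := DJ \o phi.
  pose g : {lrmorphism freeCom R (rct m) -> freeCom2 R (hcoord m)} :=
    (tensmap phi phi : freeCom2 R _ -> freeCom2 R _) \o DI.
  apply: (freeCom_ext (f := f) (g := g)) => c /=.
  rewrite phig !algext_gen; symmetry.
  exact: to_coord_coprod_gen.
have phiE x : counit (phi x) = counit x.
  by apply: counit_morph => c; rewrite phig /counit mcoeffU cm1_eq1.
exists phi; split=> //; first exact: to_coord_bij.
(* Triangularity is checked on generators: once [c (x) 1] is cancelled, the left factors are 1, of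
   weight 0, and contractions, of weight less than that of [c]. *)
move=> SI SJ; apply: (@antipode_morph R _ _ (@rct_weight m) DI) => // c.
have -> : DI (gen R c) = rct_coprod_gen R c by exact: algext_gen.
rewrite /rct_coprod_gen.
have -> (a b s : freeCom2 R (rct m)) : a + b + s - a = b + s.
  by rewrite addrC !addrA addNr add0r.
apply: wt_belowD.
  by apply: (@wt_below_tens _ _ _ _ mone); rewrite wt1.
apply: wt_below_sum => P exP; apply: wt_below_sum => l _.
apply: (@wt_below_tens _ _ _ _ (ucm (contract l))).
by rewrite wtU contract_weight.
Qed.
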